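(* Let $\mathbf{mG}$ be the category of monadic Gödel algebras and $\mathbf{mN}_c$ the category of monadic $N_c$-algebras (morphisms: algebra homomorphisms). The functors $\mathbf{K}:\mathbf{mG}\to\mathbf{mN}_c$ and $C:\mathbf{mN}_c\to\mathbf{mG}$ establish a categorical equivalence between $\mathbf{mG}$ and $\mathbf{mN}_c$, with natural isomorphisms $\alpha_{\mathbf{G}}:\mathbf{G}\to C(\mathbf{K}(\mathbf{G}))$, $\alpha(x)=(x,0)$, and $\beta_{\mathbf{U}}:\mathbf{U}\to\mathbf{K}(C(\mathbf{U}))$, $\beta(x)=(x\vee c,\sim x\vee c)$.
   Context: A Heyting algebra is $\langle A,\vee,\wedge,\Rightarrow,0,1\rangle$ with bounded lattice reduct satisfying $x\wedge(x\Rightarrow y)=x\wedge y$, $x\wedge(y\Rightarrow z)=x\wedge((x\wedge y)\Rightarrow(x\wedge z))$, $(x\wedge y)\Rightarrow x=1$. A monadic Heyting algebra is $(\mathbf{A},\forall,\exists)$ with unary operations satisfying $\forall x\leq x$, $x\leq\exists x$, $\forall(x\wedge y)=\forall x\wedge\forall y$, $\exists(x\vee y)=\exists x\vee\exists y$, $\forall 1=1$, $\exists 0=0$, $\forall\exists x=\exists x$, $\exists\forall x=\forall x$, $\forall(x\Rightarrow y)\leq\exists x\Rightarrow\exists y$. A monadic Gödel algebra is a monadic Heyting algebra satisfying $(x\Rightarrow y)\vee(y\Rightarrow x)=1$ and $\forall(\exists x\vee y)=\exists x\vee\forall y$. A De Morgan algebra is a bounded distributive lattice with a unary $\sim$ satisfying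 $\sim\sim x=x$, $\sim(x\vee y)=\sim x\wedge\sim y$; a Kleene algebra is a De Morgan algebra with $x\wedge\sim x\leq y\vee\sim y$. A Nelson algebra is $\mathbf{T}=\langle T,\vee,\wedge,\to,\sim,0,1\rangle$ with Kleene reduct satisfying $x\to x=1$, $x\to(y\to z)=(x\wedge y)\to z$, $x\wedge(x\to y)=x\wedge(\sim x\vee y)$; prelinear if $(x\to y)\vee(y\to x)=1$; centered if there is a (unique) $c$ with $\sim c=c$. A monadic Nelson algebra is $(\mathbf{T},\exists)$ with, writing $\forall x:=\sim\exists(\sim x)$: $\exists 0=0$; $x\leq\exists x$; $\exists(x\wedge\exists y)=\exists x\wedge\exists y$; $\exists(x\vee y)=\exists x\vee\exists y$; $\forall\exists x=\exists x$; $\forall(x\to y)\leq\exists x\to\exists y$; $\forall(x\to y)\leq\forall x\to\forall y$. A monadic $N_c$-algebra is a monadic Nelson algebra with $\mathbf{T}$ prelinear and centered with center $c$ and $c\in\exists(T)$. Functor $\mathbf{K}$: for a monadic Gödel algebra $\mathbf{G}=(\mathbf{A},\forall,\exists)$, $\mathbf{K}(\mathbf{G})$ has universe $K(A)=\{(a,b)\in A\times A:a\wedge b=0\}$, operations $(a,b)\vee(d,e)=(a\vee d,b\wedge e)$, $(a,b)\wedge(d,e)=(a\wedge d,b\vee e)$, $(a,b)\to(d,e)=(a\Rightarrow d,a\wedge e)$, $\sim(a,b)=(b,a)$, $0=(0,1)$, $1=(1,0)$, center $(0,0)$, and $\exists_K(a,b)=(\exists a,\forall b)$; on morphisms $\mathbf{K}(f)(a,b)=(f(a),f(b))$.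 Functor $C$: for a monadic $N_c$-algebra $\mathbf{U}=(\mathbf{T},\exists)$ with center $c$, $C(\mathbf{U})$ has universe $C(T)=\{x\in T: x\geq c\}$ with the restrictions of $\wedge,\vee,\to$ (as Heyting implication), $\exists$, and $\forall x=\sim\exists\sim x$, bottom $c$, top $1$; on morphisms $C(f)(x)=f(x)$. *)

(* Defs.v *)
From HB Require Import structures.
From mathcomp Require Import all_boot all_order boolp.

Set Implicit Arguments.
Unset Strict Implicit.
Unset Printing Implicit Defensive.

Import Order.TTheory.
Local Open Scope order_scope.

(* Algebras extend the bounded lattices of the order library: their order is  *)
(* the lattice order, carriers are choiceTypes, and the display d, common to  *)
(* all the algebras involved, has no mathematical content. Trivial            *)
(* (one-element) algebras are allowed.                                        *)

Reserved Notation "x `=> y" (at level 54, right associativity).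
Reserved Notation "x `-> y" (at level 54, right associativity).

HB.mixin Record isHeyting (d : Order.disp_t) H of Order.TBLattice d H := {
  himp : H -> H -> H;
  meet_himp : forall x y, x `&` himp x y = x `&` y;
  meet_himpr : forall x y z, x `&` himp y z = x `&` himp (x `&` y) (x `&` z);
  himp_meetl : forall x y, himp (x `&` y) x = \top
}.

#[short(type="heytingType")]
HB.structure Definition Heyting (d : Order.disp_t) :=
  { H of isHeyting d H & Order.TBLattice d H }.

Notation "x `=> y" := (himp x y) : order_scope.

HB.mixin Record isMonadicHeyting (d : Order.disp_t) H of Heyting d H := {
  hforall : H -> H;
  hexists : H -> H;
  hforall_le : forall x, hforall x <= x;
  hexists_ge : forall x, x <= hexists x;
  hforallI : forall x y, hforall (x `&` y) = hforall x `&` hforall y;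
  hexistsU : forall x y, hexists (x `|` y) = hexists x `|` hexists y;
  hforall1 : hforall \top = \top;
  hexists0 : hexists \bot = \bot;
  hforall_hexists : forall x, hforall (hexists x) = hexists x;
  hexists_hforall : forall x, hexists (hforall x) = hforall x;
  hforall_himp : forall x y, hforall (x `=> y) <= (hexists x `=> hexists y)
}.

#[short(type="monadicHeytingType")]
HB.structure Definition MonadicHeyting (d : Order.disp_t) :=
  { H of isMonadicHeyting d H & Heyting d H }.

HB.mixin Record isMonadicGodel (d : Order.disp_t) G of MonadicHeyting d G := {
  himp_prelinear : forall x y : G, (x `=> y) `|` (y `=> x) = \top;
  hforall_hexistsU :
    forall x y : G, hforall (hexists x `|` y) = hexists x `|` hforall y
}.

#[short(type="monadicGodelType")]
HB.structure Definition MonadicGodel (d : Order.disp_t) :=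
  { G of isMonadicGodel d G & MonadicHeyting d G }.

HB.mixin Record isDeMorgan (d : Order.disp_t) T of Order.TBDistrLattice d T := {
  dneg : T -> T;
  dnegK : forall x, dneg (dneg x) = x;
  dnegU : forall x y, dneg (x `|` y) = dneg x `&` dneg y
}.

#[short(type="deMorganType")]
HB.structure Definition DeMorgan (d : Order.disp_t) :=
  { T of isDeMorgan d T & Order.TBDistrLattice d T }.

HB.mixin Record isKleene (d : Order.disp_t) T of DeMorgan d T := {
  kleene : forall x y : T, x `&` dneg x <= y `|` dneg y
}.

#[short(type="kleeneType")]
HB.structure Definition Kleene (d : Order.disp_t) :=
  { T of isKleene d T & DeMorgan d T }.

HB.mixin Record isNelson (d : Order.disp_t) T of Kleene d T := {
  nimp : T -> T -> T;
  nimpxx : forall x, nimp x x = \top;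
  nimpA : forall x y z, nimp x (nimp y z) = nimp (x `&` y) z;
  meet_nimp : forall x y, x `&` nimp x y = x `&` (dneg x `|` y)
}.

#[short(type="nelsonType")]
HB.structure Definition Nelson (d : Order.disp_t) :=
  { T of isNelson d T & Kleene d T }.

Notation "x `-> y" := (nimp x y) : order_scope.

(* In the last three axioms dneg (nexists (dneg x)) is nforall x, which can   *)
(* only be introduced after the structure.                                    *)
HB.mixin Record isMonadicNelson (d : Order.disp_t) T of Nelson d T := {
  nexists : T -> T;
  nexists0 : nexists \bot = \bot;
  nexists_ge : forall x, x <= nexists x;
  nexistsI : forall x y, nexists (x `&` nexists y) = nexists x `&` nexists y;
  nexistsU : forall x y, nexists (x `|` y) = nexists x `|` nexists y;
  nforall_nexists_subproof :
    forall x, dneg (nexists (dneg (nexists x))) = nexists x;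
  nforall_nimp_nexists_subproof :
    forall x y, dneg (nexists (dneg (x `-> y))) <= (nexists x `-> nexists y);
  nforall_nimp_nforall_subproof :
    forall x y, dneg (nexists (dneg (x `-> y))) <=
                  (dneg (nexists (dneg x)) `-> dneg (nexists (dneg y)))
}.

#[short(type="monadicNelsonType")]
HB.structure Definition MonadicNelson (d : Order.disp_t) :=
  { T of isMonadicNelson d T & Nelson d T }.

Definition nforall (d : Order.disp_t) (T : monadicNelsonType d) (x : T) : T :=
  dneg (nexists (dneg x)).

(* The center is recorded as data because it is unique, see center_uniq.      *)
HB.mixin Record isMonadicNc (d : Order.disp_t) T of MonadicNelson d T := {
  nimp_prelinear : forall x y : T, (x `-> y) `|` (y `-> x) = \top;
  center : T;
  dneg_center : dneg center = center;
  center_nexists : exists x : T, nexists x = center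
}.

#[short(type="monadicNcType")]
HB.structure Definition MonadicNc (d : Order.disp_t) :=
  { T of isMonadicNc d T & MonadicNelson d T }.

Arguments center {d s}.

Section HeytingTheory.
Context {d : Order.disp_t} {H : heytingType d}.
Implicit Types x y z : H.

Lemma le_himp x y z : (x <= y `=> z) = (x `&` y <= z).
Proof.
apply/idP/idP => le_xyz.
  by apply: (le_trans (leI2 le_xyz (lexx y))); rewrite meetC meet_himp leIr.
have E : x `&` (y `=> z) = x.
  rewrite meet_himpr.
  have -> : x `&` y = (x `&` z) `&` (x `&` y).
    by apply/esym/meet_idPr; rewrite lexI leIl.
  by rewrite himp_meetl meetx1.
by rewrite -E leIr.
Qed.

Lemma heyting_meetUl : left_distributive (@Order.meet d H) (@Order.join d H).
Proof.
move=> x y z; apply/le_anti/andP; split; last first.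
  by rewrite leUx !lexI !leIr !leIxl ?leUl ?leUr.
by rewrite -le_himp leUx !le_himp leUl leUr.
Qed.

Lemma heyting_joinIl : left_distributive (@Order.join d H) (@Order.meet d H).
Proof.
move=> x y z; rewrite heyting_meetUl joinKIC [x `&` (_ `|` _)]meetC.
by rewrite heyting_meetUl -joinA meetUKC [y `&` x]meetC.
Qed.

Lemma himp_curry x y z : x `=> y `=> z = (x `&` y) `=> z.
Proof.
apply/le_anti/andP; split.
  by rewrite le_himp meetA -!le_himp.
by rewrite !le_himp -meetA -le_himp.
Qed.

Lemma himpxx x : x `=> x = \top.
Proof. by rewrite -{1}[x]meetxx himp_meetl. Qed.

End HeytingTheory.

Section MonadicHeytingTheory.
Context {d : Order.disp_t} {H : monadicHeytingType d}.
Implicit Types x y z : H.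

Lemma le_hexists x y : x <= y -> hexists x <= hexists y.
Proof. by move=> /join_idPl <-; rewrite hexistsU leUr. Qed.

Lemma le_hforall x y : x <= y -> hforall x <= hforall y.
Proof. by move=> /meet_idPl <-; rewrite hforallI leIr. Qed.

Lemma hexistsK x : hexists (hexists x) = hexists x.
Proof. by rewrite -[hexists x]hforall_hexists hexists_hforall. Qed.

Lemma hforallK x : hforall (hforall x) = hforall x.
Proof. by rewrite -[hforall x]hexists_hforall hforall_hexists. Qed.

Lemma hforall0 : hforall (\bot : H) = \bot.
Proof. by apply/eqP; rewrite -lex0 hforall_le. Qed.

Lemma hexistsI x y : hexists (x `&` hexists y) = hexists x `&` hexists y.
Proof.
apply/le_anti/andP; split.
  by rewrite lexI le_hexists ?leIl // -[leRHS]hexistsK le_hexists ?leIr.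
rewrite meetC -le_himp; apply: le_trans (hforall_himp _ _).
by rewrite -{1}[hexists y]hforall_hexists le_hforall // le_himp meetC.
Qed.

Lemma hexistsIforall x y : hexists (x `&` hforall y) = hexists x `&` hforall y.
Proof. by rewrite -[hforall y]hexists_hforall hexistsI. Qed.

End MonadicHeytingTheory.

Section NelsonTheory.
Context {d : Order.disp_t}.

Section DeMorganTheory.
Context {T : deMorganType d}.
Implicit Types x y : T.

Lemma dnegI x y : dneg (x `&` y) = dneg x `|` dneg y.
Proof. by rewrite -[RHS]dnegK dnegU !dnegK. Qed.

Lemma le_dneg x y : (dneg x <= dneg y) = (y <= x).
Proof.
have anti u v : v <= u -> dneg u <= dneg v.
  by move=> /join_idPl <-; rewrite dnegU leIr.
by apply/idP/idP => /anti; rewrite ?dnegK.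
Qed.

Lemma dneg1 : dneg (\top : T) = \bot.
Proof. by apply/eqP; rewrite -lex0 -[\bot]dnegK le_dneg lex1. Qed.

Lemma dneg0 : dneg (\bot : T) = \top.
Proof. by rewrite -dneg1 dnegK. Qed.

End DeMorganTheory.

Lemma center_uniq (T : monadicNcType d) (x : T) : dneg x = x -> x = center.
Proof.
move=> nx; apply/le_anti.
have := kleene x (center : T); rewrite nx dneg_center meetxx joinxx => ->.
by have := kleene (center : T) x; rewrite nx dneg_center meetxx joinxx => ->.
Qed.

Section NelsonImp.
Context {T : nelsonType d}.
Implicit Types x y : T.

Lemma nimpx1 x : x `-> \top = \top.
Proof. by rewrite -{1}(nimpxx x) nimpA meetxx nimpxx. Qed.

Lemma le_nimp1 x y : x <= y -> x `-> y = \top.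
Proof. by move=> /meet_idPl <-; rewrite -nimpA nimpxx nimpx1. Qed.

Lemma nimp1_le x y : x `-> y = \top -> x <= dneg x `|` y.
Proof.
by move=> E; have := meet_nimp x y; rewrite E meetx1 => /esym/meet_idPl.
Qed.

End NelsonImp.

Section MonadicNelsonTheory.
Context {T : monadicNelsonType d}.
Implicit Types x y : T.

Lemma nexists1 : nexists (\top : T) = \top.
Proof. by apply/eqP; rewrite -le1x nexists_ge. Qed.

Lemma nexistsK x : nexists (nexists x) = nexists x.
Proof. by have := nexistsI \top x; rewrite nexists1 !meet1x. Qed.

Lemma nforall_nexists x : nforall (nexists x) = nexists x.
Proof. exact: nforall_nexists_subproof. Qed.

Lemma nexists_nforall x : nexists (nforall x) = nforall x.
Proof.
apply: (can_inj (@dnegK d T)); rewrite -/(nforall _) [RHS]dnegK.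
exact: nforall_nexists.
Qed.

Lemma nforall_nimp x y : nforall (x `-> y) <= (nexists x `-> nexists y).
Proof. exact: nforall_nimp_nexists_subproof. Qed.

Lemma nforall_le x : nforall x <= x.
Proof. by rewrite -[leRHS]dnegK le_dneg nexists_ge. Qed.

Lemma nforallI x y : nforall (x `&` y) = nforall x `&` nforall y.
Proof. by rewrite /nforall dnegI nexistsU dnegU. Qed.

Lemma nforall1 : nforall (\top : T) = \top.
Proof. by rewrite /nforall dneg1 nexists0 dneg0. Qed.

Lemma le_nforall x y : x <= y -> nforall x <= nforall y.
Proof. by move=> /meet_idPl <-; rewrite nforallI leIr. Qed.

Lemma nforall_nexistsU x y :
  nforall (nexists x `|` y) = nexists x `|` nforall y.
Proof.
have E : dneg (nexists x) = nexists (dneg (nexists x)).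
  by rewrite -[LHS]/(dneg (nexists x)) -{1}nforall_nexists dnegK.
by rewrite /nforall dnegU meetC E nexistsI dnegI -E dnegK joinC.
Qed.

End MonadicNelsonTheory.

Section MonadicNcTheory.
Context {T : monadicNcType d}.
Implicit Types x y : T.

Lemma nexists_center : nexists (center : T) = center.
Proof. by have [x <-] := @center_nexists d T; rewrite nexistsK. Qed.

Lemma nforall_center : nforall (center : T) = center.
Proof. by rewrite /nforall dneg_center nexists_center dneg_center. Qed.

Lemma dneg_le_center x : center <= x -> dneg x <= center.
Proof. by rewrite -{2}dneg_center le_dneg. Qed.

Lemma meet_nimp_center x y : center <= x -> center <= y ->
  x `&` (x `-> y) = x `&` y.
Proof.
move=> cx cy; rewrite meet_nimp; congr (_ `&` _).
by apply/join_idPr/(le_trans (dneg_le_center cx)).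
Qed.

Lemma center_le_nimp x y : center <= x -> center <= y -> center <= x `-> y.
Proof.
move=> cx cy; have : center <= x `&` y by rewrite lexI cx.
by rewrite -meet_nimp_center // lexI => /andP[].
Qed.

Lemma le_nimp_center w x y : center <= w -> center <= x -> center <= y ->
  (w <= x `-> y) = (w `&` x <= y).
Proof.
move=> cw cx cy; apply/idP/idP => [le_w|/le_nimp1].
  apply: le_trans (leI2 le_w (lexx x)) _.
  by rewrite meetC meet_nimp_center // leIr.
rewrite -nimpA => /nimp1_le /le_trans; apply.
by rewrite leUx lexx andbT (le_trans (dneg_le_center cw)) ?center_le_nimp.
Qed.

End MonadicNcTheory.

End NelsonTheory.

Section Twist.
Context {d : Order.disp_t}.

(* The universe of K(G): pairs (a, b) with a `&` b = \bot.                    *)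
Record twist (G : monadicGodelType d) : Type :=
  Twist { twist_val :> G * G; _ : twist_val.1 `&` twist_val.2 == \bot }.

Variable G : monadicGodelType d.

HB.instance Definition _ := [isSub for @twist_val G].
HB.instance Definition _ := [Choice of twist G by <:].

Implicit Types p q r : twist G.

Lemma twistP p : p.1 `&` p.2 = \bot.
Proof. by case: p => /= p /eqP. Qed.

Lemma twist_eq p q : p.1 = q.1 -> p.2 = q.2 -> p = q.
Proof.
by move=> e1 e2; apply: val_inj; case: p q e1 e2 => [[a b] i] [[e f] j] /= -> ->.
Qed.

Lemma twist_joinP p q : (p.1 `|` q.1) `&` (p.2 `&` q.2) == \bot.
Proof.
rewrite heyting_meetUl meetA twistP meet0x join0x.
by rewrite [p.2 `&` _]meetC meetA twistP meet0x.
Qed.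

Lemma twist_dnegP p : p.2 `&` p.1 == \bot.
Proof. by rewrite meetC twistP. Qed.

Lemma twist_meetP p q : (p.1 `&` q.1) `&` (p.2 `|` q.2) == \bot.
Proof.
rewrite meetC heyting_meetUl meetA [p.2 `&` _]meetC twistP meet0x join0x.
by rewrite meetCA [q.2 `&` _]meetC twistP meetx0.
Qed.

Lemma twist_nimpP p q : (p.1 `=> q.1) `&` (p.1 `&` q.2) == \bot.
Proof. by rewrite meetA [_ `&` p.1]meetC meet_himp -meetA twistP meetx0. Qed.

Lemma twist_nexistsP p : hexists p.1 `&` hforall p.2 == \bot.
Proof.
rewrite -hexistsIforall -lex0 -[leRHS]hexists0 le_hexists //.
by rewrite -(twistP p) leI2 // hforall_le.
Qed.

Lemma twist0P : (\bot : G) `&` \top == \bot. Proof. by rewrite meet0x. Qed.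
Lemma twist1P : (\top : G) `&` \bot == \bot. Proof. by rewrite meetx0. Qed.
Lemma twistcP : (\bot : G) `&` \bot == \bot. Proof. by rewrite meet0x. Qed.

Definition twist_join p q : twist G :=
  @Twist G (p.1 `|` q.1, p.2 `&` q.2) (twist_joinP p q).
Definition twist_meet p q : twist G :=
  @Twist G (p.1 `&` q.1, p.2 `|` q.2) (twist_meetP p q).
Definition twist_nimp p q : twist G :=
  @Twist G (p.1 `=> q.1, p.1 `&` q.2) (twist_nimpP p q).
Definition twist_dneg p : twist G := @Twist G (p.2, p.1) (twist_dnegP p).
Definition twist_nexists p : twist G :=
  @Twist G (hexists p.1, hforall p.2) (twist_nexistsP p).
Definition twist0 : twist G := @Twist G (\bot, \top) twist0P.
Definition twist1 : twist G := @Twist G (\top, \bot) twist1P.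
Definition twist_center : twist G := @Twist G (\bot, \bot) twistcP.

Let twist_meetC : commutative twist_meet.
Proof. by move=> p q; apply: twist_eq; rewrite /= (meetC, joinC). Qed.
Let twist_joinC : commutative twist_join.
Proof. by move=> p q; apply: twist_eq; rewrite /= (meetC, joinC). Qed.
Let twist_meetA : associative twist_meet.
Proof. by move=> p q r; apply: twist_eq; rewrite /= (meetA, joinA). Qed.
Let twist_joinA : associative twist_join.
Proof. by move=> p q r; apply: twist_eq; rewrite /= (meetA, joinA). Qed.
Let twist_joinKI q p : twist_meet p (twist_join p q) = p.
Proof. by apply: twist_eq; rewrite /= (joinKI, meetKU). Qed.
Let twist_meetKU q p : twist_join p (twist_meet p q) = p.
Proof. by apply: twist_eq; rewrite /= (joinKI, meetKU). Qed.
Let twist_meetUl : left_distributive twist_meet twist_join.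
Proof.
by move=> p q r; apply: twist_eq; rewrite /= (heyting_meetUl, heyting_joinIl).
Qed.
Let twist_meetxx : idempotent_op twist_meet.
Proof. by move=> p; apply: twist_eq; rewrite /= (meetxx, joinxx). Qed.

HB.instance Definition _ := @Order.isMeetJoinDistrLattice.Build d (twist G)
  (fun p q => twist_meet p q == p)
  (fun p q => (q != p) && (twist_meet p q == p))
  twist_meet twist_join (fun _ _ => erefl) (fun _ _ => erefl)
  twist_meetC twist_joinC twist_meetA twist_joinA twist_joinKI twist_meetKU
  twist_meetUl twist_meetxx.

Lemma le_twistE p q : (p <= q) = (p.1 <= q.1) && (q.2 <= p.2).
Proof.
rewrite leEmeet; apply/eqP/andP => [<- /=|[le1 le2]].
  by rewrite leIr leUr.
by apply: twist_eq => /=; [apply/meet_idPl | apply/join_idPl].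
Qed.

Let twist_le0 p : twist0 <= p.
Proof. by rewrite le_twistE /= le0x lex1. Qed.
Let twist_le1 p : p <= twist1.
Proof. by rewrite le_twistE /= le0x lex1. Qed.

HB.instance Definition _ := Order.hasBottom.Build d (twist G) twist_le0.
HB.instance Definition _ := Order.hasTop.Build d (twist G) twist_le1.

Let twist_dnegK p : twist_dneg (twist_dneg p) = p.
Proof. exact: twist_eq. Qed.
Let twist_dnegU p q :
  twist_dneg (p `|` q) = twist_dneg p `&` twist_dneg q.
Proof. exact: twist_eq. Qed.

HB.instance Definition _ :=
  isDeMorgan.Build d (twist G) twist_dnegK twist_dnegU.

Let twist_kleene p q : p `&` dneg p <= q `|` dneg q.
Proof.
by rewrite le_twistE /= twistP le0x meetC twistP le0x.
Qed.

HB.instance Definition _ := isKleene.Build d (twist G) twist_kleene.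

Let twist_nimpxx p : twist_nimp p p = \top.
Proof. by apply: twist_eq; rewrite /= (himpxx, twistP). Qed.
Let twist_nimpA p q r :
  twist_nimp p (twist_nimp q r) = twist_nimp (p `&` q) r.
Proof. by apply: twist_eq; rewrite /= (himp_curry, meetA). Qed.
Let twist_meet_nimp p q : p `&` twist_nimp p q = p `&` (dneg p `|` q).
Proof.
apply: twist_eq => /=.
  rewrite meet_himp [RHS]meetC heyting_meetUl [_ `&` p.1]meetC twistP join0x.
  by rewrite meetC.
by [].
Qed.

HB.instance Definition _ :=
  isNelson.Build d (twist G) twist_nimpxx twist_nimpA twist_meet_nimp.

Let twist_nexists0 : twist_nexists \bot = \bot.
Proof. by apply: twist_eq; rewrite /= (hexists0, hforall1). Qed.
Let twist_nexists_ge p : p <= twist_nexists p.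
Proof. by rewrite le_twistE /= hexists_ge hforall_le. Qed.
Let twist_nexistsI p q :
  twist_nexists (p `&` twist_nexists q) = twist_nexists p `&` twist_nexists q.
Proof.
apply: twist_eq => /=; first by rewrite hexistsI.
by rewrite -[hforall q.2]hexists_hforall joinC hforall_hexistsU joinC.
Qed.
Let twist_nexistsU p q :
  twist_nexists (p `|` q) = twist_nexists p `|` twist_nexists q.
Proof. by apply: twist_eq; rewrite /= (hexistsU, hforallI). Qed.
Let twist_nforall_nexists p :
  dneg (twist_nexists (dneg (twist_nexists p))) = twist_nexists p.
Proof. by apply: twist_eq; rewrite /= (hforall_hexists, hexists_hforall). Qed.
Let twist_nforall_nimp p q :
  dneg (twist_nexists (dneg (p `-> q))) <= (twist_nexists p `-> twist_nexists q).
Proof.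
rewrite le_twistE /= hforall_himp /=.
by rewrite -hexistsIforall le_hexists // leI2 // hforall_le.
Qed.
Let twist_nforall_nimp_nforall p q :
  dneg (twist_nexists (dneg (p `-> q))) <=
  (dneg (twist_nexists (dneg p)) `-> dneg (twist_nexists (dneg q))).
Proof.
rewrite le_twistE /= le_himp -hforallI le_hforall; last first.
  by rewrite meetC meet_himp leIr.
by rewrite meetC -hexistsIforall le_hexists // meetC leI2 // hforall_le.
Qed.

HB.instance Definition _ := isMonadicNelson.Build d (twist G)
  twist_nexists0 twist_nexists_ge twist_nexistsI twist_nexistsU
  twist_nforall_nexists twist_nforall_nimp twist_nforall_nimp_nforall.

Let twist_prelinear p q : (p `-> q) `|` (q `-> p) = \top.
Proof.
apply: twist_eq => /=; first by rewrite himp_prelinear.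
by rewrite meetACA [q.2 `&` _]meetC meetACA !twistP meet0x.
Qed.
Let twist_dneg_center : dneg twist_center = twist_center.
Proof. exact: twist_eq. Qed.
Let twist_center_nexists : exists p : twist G, nexists p = twist_center.
Proof.
by exists twist_center; apply: twist_eq; rewrite /= (hexists0, hforall0).
Qed.

HB.instance Definition _ := isMonadicNc.Build d (twist G)
  twist_prelinear twist_dneg_center twist_center_nexists.

End Twist.

Section Cone.
Context {d : Order.disp_t}.

(* The universe of C(U): elements above the center, which becomes the bottom. *)
Record cone (U : monadicNcType d) : Type :=
  Cone { cone_val : U; _ : center <= cone_val }.

Variable U : monadicNcType d.

HB.instance Definition _ := [isSub for @cone_val U].
HB.instance Definition _ := [Choice of cone U by <:].

Implicit Types x y z : cone U.

Lemma coneP x : center <= cone_val x.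
Proof. by case: x. Qed.

Lemma cone_joinP x y : center <= cone_val x `|` cone_val y.
Proof. by rewrite lexUl ?coneP. Qed.
Lemma cone_meetP x y : center <= cone_val x `&` cone_val y.
Proof. by rewrite lexI !coneP. Qed.
Lemma cone_himpP x y : center <= cone_val x `-> cone_val y.
Proof. by rewrite center_le_nimp ?coneP. Qed.
Lemma cone_hexistsP x : center <= nexists (cone_val x).
Proof. by rewrite (le_trans (coneP x)) ?nexists_ge. Qed.
Lemma cone_hforallP x : center <= nforall (cone_val x).
Proof. by rewrite -nforall_center le_nforall ?coneP. Qed.

Definition cone_join x y : cone U := Cone (cone_joinP x y).
Definition cone_meet x y : cone U := Cone (cone_meetP x y).
Definition cone_himp x y : cone U := Cone (cone_himpP x y).
Definition cone_hexists x : cone U := Cone (cone_hexistsP x).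
Definition cone_hforall x : cone U := Cone (cone_hforallP x).
Definition cone0 : cone U := @Cone U center (lexx _).
Definition cone1 : cone U := @Cone U \top (lex1 _).

Let cone_meetC : commutative cone_meet.
Proof. by move=> x y; apply: val_inj; rewrite /= meetC. Qed.
Let cone_joinC : commutative cone_join.
Proof. by move=> x y; apply: val_inj; rewrite /= joinC. Qed.
Let cone_meetA : associative cone_meet.
Proof. by move=> x y z; apply: val_inj; rewrite /= meetA. Qed.
Let cone_joinA : associative cone_join.
Proof. by move=> x y z; apply: val_inj; rewrite /= joinA. Qed.
Let cone_joinKI y x : cone_meet x (cone_join x y) = x.
Proof. by apply: val_inj; rewrite /= joinKI. Qed.
Let cone_meetKU y x : cone_join x (cone_meet x y) = x.
Proof. by apply: val_inj; rewrite /= meetKU. Qed.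
Let cone_meetUl : left_distributive cone_meet cone_join.
Proof. by move=> x y z; apply: val_inj; rewrite /= meetUl. Qed.
Let cone_meetxx : idempotent_op cone_meet.
Proof. by move=> x; apply: val_inj; rewrite /= meetxx. Qed.

HB.instance Definition _ := @Order.isMeetJoinDistrLattice.Build d (cone U)
  (fun x y => cone_meet x y == x)
  (fun x y => (y != x) && (cone_meet x y == x))
  cone_meet cone_join (fun _ _ => erefl) (fun _ _ => erefl)
  cone_meetC cone_joinC cone_meetA cone_joinA cone_joinKI cone_meetKU
  cone_meetUl cone_meetxx.

Lemma le_coneE x y : (x <= y) = (cone_val x <= cone_val y).
Proof. by rewrite !leEmeet -(inj_eq val_inj). Qed.

Let cone_le0 x : cone0 <= x.
Proof. by rewrite le_coneE /= coneP. Qed.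
Let cone_le1 x : x <= cone1.
Proof. by rewrite le_coneE /= lex1. Qed.

HB.instance Definition _ := Order.hasBottom.Build d (cone U) cone_le0.
HB.instance Definition _ := Order.hasTop.Build d (cone U) cone_le1.

Let le_cone_himp x y z : (x <= cone_himp y z) = (x `&` y <= z).
Proof. by rewrite !le_coneE /= le_nimp_center ?coneP. Qed.

Let cone_meet_himp x y : x `&` cone_himp x y = x `&` y.
Proof. by apply: val_inj; rewrite /= meet_nimp_center ?coneP. Qed.
Let cone_meet_himpr x y z :
  x `&` cone_himp y z = x `&` cone_himp (x `&` y) (x `&` z).
Proof.
apply/le_anti/andP; split; rewrite lexI leIl le_cone_himp.
  rewrite meetACA meetxx [_ `&` y]meetC cone_meet_himp.
  by rewrite lexI leIl meetA leIr.
set w := cone_himp _ _.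
have -> : x `&` w `&` y = (x `&` y) `&` w by rewrite -!meetA [w `&` y]meetC.
by rewrite cone_meet_himp meetCA leIx2 // leIr orbT.
Qed.
Let cone_himp_meetl x y : cone_himp (x `&` y) x = \top.
Proof. by apply: val_inj; rewrite /= le_nimp1 ?leIl. Qed.

HB.instance Definition _ := isHeyting.Build d (cone U)
  cone_meet_himp cone_meet_himpr cone_himp_meetl.

Let cone_hforall_le x : cone_hforall x <= x.
Proof. by rewrite le_coneE nforall_le. Qed.
Let cone_hexists_ge x : x <= cone_hexists x.
Proof. by rewrite le_coneE nexists_ge. Qed.
Let cone_hforallI x y :
  cone_hforall (x `&` y) = cone_hforall x `&` cone_hforall y.
Proof. by apply: val_inj; rewrite /= nforallI. Qed.
Let cone_hexistsU x y :
  cone_hexists (x `|` y) = cone_hexists x `|` cone_hexists y.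
Proof. by apply: val_inj; rewrite /= nexistsU. Qed.
Let cone_hforall1 : cone_hforall \top = \top.
Proof. by apply: val_inj; rewrite /= nforall1. Qed.
Let cone_hexists0 : cone_hexists \bot = \bot.
Proof. by apply: val_inj; rewrite /= nexists_center. Qed.
Let cone_hforall_hexists x : cone_hforall (cone_hexists x) = cone_hexists x.
Proof. by apply: val_inj; rewrite /= nforall_nexists. Qed.
Let cone_hexists_hforall x : cone_hexists (cone_hforall x) = cone_hforall x.
Proof. by apply: val_inj; rewrite /= nexists_nforall. Qed.
Let cone_hforall_himp x y :
  cone_hforall (x `=> y) <= (cone_hexists x `=> cone_hexists y).
Proof. by rewrite le_coneE nforall_nimp. Qed.

HB.instance Definition _ := isMonadicHeyting.Build d (cone U)
  cone_hforall_le cone_hexists_ge cone_hforallI cone_hexistsU cone_hforall1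
  cone_hexists0 cone_hforall_hexists cone_hexists_hforall cone_hforall_himp.

Let cone_prelinear x y : (x `=> y) `|` (y `=> x) = \top.
Proof. by apply: val_inj; rewrite /= nimp_prelinear. Qed.
Let cone_hforall_hexistsU x y :
  hforall (hexists x `|` y) = hexists x `|` hforall y.
Proof. by apply: val_inj; rewrite /= nforall_nexistsU. Qed.

HB.instance Definition _ := isMonadicGodel.Build d (cone U)
  cone_prelinear cone_hforall_hexistsU.

End Cone.

Record category := Category {
  Ob :> Type;
  Hom : Ob -> Ob -> Type;
  idm : forall A, Hom A A;
  comp : forall A B C, Hom B C -> Hom A B -> Hom A C;
  comp_idl : forall A B (f : Hom A B), comp (idm B) f = f;
  comp_idr : forall A B (f : Hom A B), comp f (idm A) = f;
  compA : forall A B C D (h : Hom C D) (g : Hom B C) (f : Hom A B),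
    comp h (comp g f) = comp (comp h g) f
}.
Arguments idm {c} A.

Record functor (C D : category) := Functor {
  fob :> C -> D;
  fmap : forall A B, Hom A B -> Hom (fob A) (fob B);
  fmap_id : forall A, fmap (idm A) = idm (fob A);
  fmap_comp : forall (X Y Z : C) (g : Hom Y Z) (f : Hom X Y),
    fmap (comp g f) = comp (fmap g) (fmap f)
}.
Arguments fmap {C D} _ {A B} _.

Definition functor_id (C : category) : functor C C :=
  @Functor C C id (fun _ _ => id) (fun _ => erefl) (fun _ _ _ _ _ => erefl).

Section FunctorComp.
Variables (C D E : category) (G : functor D E) (F : functor C D).

Let map A B (f : Hom A B) : Hom (G (F A)) (G (F B)) := fmap G (fmap F f).
Let map_id A : map (idm A) = idm (G (F A)).
Proof. by rewrite /map !fmap_id. Qed.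
Let map_comp X Y Z (g : Hom Y Z) (f : Hom X Y) :
  map (comp g f) = comp (map g) (map f).
Proof. by rewrite /map !fmap_comp. Qed.

Definition functor_comp : functor C E :=
  @Functor C E (fun A => G (F A)) map map_id map_comp.

End FunctorComp.

Definition is_iso (C : category) (A B : C) (f : Hom A B) : Prop :=
  exists g : Hom B A, comp g f = idm A /\ comp f g = idm B.

Record nat_iso (C D : category) (F G : functor C D) := NatIso {
  component :> forall A : C, Hom (F A) (G A);
  naturality : forall (A B : C) (f : Hom A B),
    comp (component B) (fmap F f) = comp (fmap G f) (component A);
  component_iso : forall A : C, is_iso (component A)
}.

Record equivalence (C D : category) (F : functor C D) (G : functor D C) :=
  Equivalence {
    equiv_unit : nat_iso (functor_id C) (functor_comp G F);
    equiv_counit : nat_iso (functor_id D) (functor_comp F G)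
  }.

Section MonadicGodelCategory.
Context {d : Order.disp_t}.

Record monadicGodel_morphism (A B : monadicGodelType d) (f : A -> B) : Prop := {
  mG_meet : {morph f : x y / x `&` y};
  mG_join : {morph f : x y / x `|` y};
  mG_himp : {morph f : x y / x `=> y};
  mG_bot : f \bot = \bot;
  mG_top : f \top = \top;
  mG_forall : {morph f : x / hforall x};
  mG_exists : {morph f : x / hexists x}
}.

Record monadicGodel_hom (A B : monadicGodelType d) := MonadicGodelHom {
  mG_fun :> A -> B;
  mG_morph : monadicGodel_morphism mG_fun
}.

Lemma mG_hom_eq A B (f g : monadicGodel_hom A B) : f =1 g -> f = g.
Proof.
case: f g => [f fP] [g gP] /= /funext fg; case: _ / fg in gP *.
by rewrite (Prop_irrelevance fP gP).
Qed.

Definition mG_id (A : monadicGodelType d) : monadicGodel_hom A A.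
Proof. by exists id. Defined.

Definition mG_comp (A B C : monadicGodelType d)
  (g : monadicGodel_hom B C) (f : monadicGodel_hom A B) : monadicGodel_hom A C.
Proof.
exists (g \o f).
case: f g => [f []] fI fU fi f0 f1 ff fe [g []] gI gU gi g0 g1 gf ge.
by split=> [x y|x y|x y|||x|x] /=;
  rewrite ?(fI, fU, fi, f0, f1, ff, fe) ?(gI, gU, gi, g0, g1, gf, ge).
Defined.

Lemma mG_comp_idl (A B : monadicGodelType d) (f : monadicGodel_hom A B) :
  mG_comp (mG_id B) f = f.
Proof. exact: mG_hom_eq. Qed.

Lemma mG_comp_idr (A B : monadicGodelType d) (f : monadicGodel_hom A B) :
  mG_comp f (mG_id A) = f.
Proof. exact: mG_hom_eq. Qed.

Lemma mG_compA (A B C D : monadicGodelType d) (h : monadicGodel_hom C D)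
    (g : monadicGodel_hom B C) (f : monadicGodel_hom A B) :
  mG_comp h (mG_comp g f) = mG_comp (mG_comp h g) f.
Proof. exact: mG_hom_eq. Qed.

End MonadicGodelCategory.

Definition mG (d : Order.disp_t) : category :=
  @Category (monadicGodelType d) monadicGodel_hom mG_id mG_comp
    mG_comp_idl mG_comp_idr mG_compA.

Section MonadicNcCategory.
Context {d : Order.disp_t}.

(* Preservation of the center is not required since it follows (mN_center).   *)
Record monadicNc_morphism (T U : monadicNcType d) (f : T -> U) : Prop := {
  mN_meet : {morph f : x y / x `&` y};
  mN_join : {morph f : x y / x `|` y};
  mN_nimp : {morph f : x y / x `-> y};
  mN_dneg : {morph f : x / dneg x};
  mN_bot : f \bot = \bot;
  mN_top : f \top = \top;
  mN_exists : {morph f : x / nexists x}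
}.

Record monadicNc_hom (T U : monadicNcType d) := MonadicNcHom {
  mN_fun :> T -> U;
  mN_morph : monadicNc_morphism mN_fun
}.

Lemma mN_hom_eq T U (f g : monadicNc_hom T U) : f =1 g -> f = g.
Proof.
case: f g => [f fP] [g gP] /= /funext fg; case: _ / fg in gP *.
by rewrite (Prop_irrelevance fP gP).
Qed.

Definition mN_id (T : monadicNcType d) : monadicNc_hom T T.
Proof. by exists id. Defined.

Definition mN_comp (T U V : monadicNcType d)
  (g : monadicNc_hom U V) (f : monadicNc_hom T U) : monadicNc_hom T V.
Proof.
exists (g \o f).
case: f g => [f []] fI fU fi fn f0 f1 fe [g []] gI gU gi gn g0 g1 ge.
by split=> [x y|x y|x y|x|||x] /=;
  rewrite ?(fI, fU, fi, fn, f0, f1, fe) ?(gI, gU, gi, gn, g0, g1, ge).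
Defined.

Lemma mN_center T U (f : monadicNc_hom T U) : f center = center.
Proof. by apply: center_uniq; rewrite -(mN_dneg (mN_morph f)) dneg_center. Qed.

Lemma mN_comp_idl (A B : monadicNcType d) (f : monadicNc_hom A B) :
  mN_comp (mN_id B) f = f.
Proof. exact: mN_hom_eq. Qed.

Lemma mN_comp_idr (A B : monadicNcType d) (f : monadicNc_hom A B) :
  mN_comp f (mN_id A) = f.
Proof. exact: mN_hom_eq. Qed.

Lemma mN_compA (A B C D : monadicNcType d) (h : monadicNc_hom C D)
    (g : monadicNc_hom B C) (f : monadicNc_hom A B) :
  mN_comp h (mN_comp g f) = mN_comp (mN_comp h g) f.
Proof. exact: mN_hom_eq. Qed.

End MonadicNcCategory.

Definition mNc (d : Order.disp_t) : category :=
  @Category (monadicNcType d) monadicNc_hom mN_id mN_comp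
    mN_comp_idl mN_comp_idr mN_compA.

Section FunctorK.
Context {d : Order.disp_t}.

Section Map.
Variables (A B : monadicGodelType d) (f : monadicGodel_hom A B).

Lemma twist_mapP (p : twist A) : f p.1 `&` f p.2 == \bot.
Proof. by case: f => g [gI _ _ g0 _ _ _] /=; rewrite -gI twistP g0. Qed.

Definition twist_map (p : twist A) : twist B :=
  @Twist d B (f p.1, f p.2) (twist_mapP p).

Lemma twist_map_morphism : monadicNc_morphism twist_map.
Proof.
have [fI fU fi f0 f1 ff fe] := mG_morph f.
by split=> [x y|x y|x y|x|||x]; apply: twist_eq;
  rewrite /= ?(fI, fU, fi, f0, f1, ff, fe).
Qed.

Definition twist_hom : monadicNc_hom (twist A) (twist B) :=
  MonadicNcHom twist_map_morphism.

End Map.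

Lemma twist_hom_id (A : monadicGodelType d) :
  twist_hom (mG_id A) = mN_id (twist A).
Proof. by apply: mN_hom_eq => p; apply: twist_eq. Qed.

Lemma twist_hom_comp (A B C : monadicGodelType d)
    (g : monadicGodel_hom B C) (f : monadicGodel_hom A B) :
  twist_hom (mG_comp g f) = mN_comp (twist_hom g) (twist_hom f).
Proof. by apply: mN_hom_eq => p; apply: twist_eq. Qed.

End FunctorK.

Definition functorK (d : Order.disp_t) : functor (mG d) (mNc d) :=
  @Functor (mG d) (mNc d) (fun A => twist A) (fun _ _ f => twist_hom f)
    twist_hom_id (fun _ _ _ g f => twist_hom_comp g f).

Section FunctorC.
Context {d : Order.disp_t}.

Section Map.
Variables (T U : monadicNcType d) (f : monadicNc_hom T U).

Lemma cone_mapP (x : cone T) : center <= f (cone_val x).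
Proof.
by rewrite leEmeet -(mN_center f) -(mN_meet (mN_morph f));
  apply/eqP; congr (f _); apply/meet_idPl/coneP.
Qed.

Definition cone_map (x : cone T) : cone U := Cone (cone_mapP x).

Lemma cone_map_morphism : monadicGodel_morphism cone_map.
Proof.
have [fI fU fi fn f0 f1 fe] := mN_morph f.
by split=> [x y|x y|x y|||x|x]; apply: val_inj;
  rewrite /= /nforall ?(fI, fU, fi, fn, f1, fe, mN_center).
Qed.

Definition cone_hom : monadicGodel_hom (cone T) (cone U) :=
  MonadicGodelHom cone_map_morphism.

End Map.

Lemma cone_hom_id (T : monadicNcType d) : cone_hom (mN_id T) = mG_id (cone T).
Proof. by apply: mG_hom_eq => x; apply: val_inj. Qed.

Lemma cone_hom_comp (T U V : monadicNcType d)
    (g : monadicNc_hom U V) (f : monadicNc_hom T U) :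
  cone_hom (mN_comp g f) = mG_comp (cone_hom g) (cone_hom f).
Proof. by apply: mG_hom_eq => x; apply: val_inj. Qed.

End FunctorC.

Definition functorC (d : Order.disp_t) : functor (mNc d) (mG d) :=
  @Functor (mNc d) (mG d) (fun T => cone T) (fun _ _ f => cone_hom f)
    cone_hom_id (fun _ _ _ g f => cone_hom_comp g f).

(* Main.v *)
(** In a Nelson algebra [x `-> y] is the greatest [z] such that
    [x `&` z <= dneg x `|` y]. In the presence of the center [c] this yields
    [(x `-> y) `|` c = (x `|` c) `-> (y `|` c)] and
    [dneg (x `-> y) `|` c = (x `|` c) `&` (dneg y `|` c)], that is, beta preserves
    the implication. Beta is injective because [x] is determined by [x `|` c] and
    [x `&` c], and [a `&` (b `-> \bot)] is a preimage of [(a, b)]. *)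

Require Import Defs.
From HB Require Import structures.
From mathcomp Require Import all_boot all_order boolp.

Import Order.TTheory.
Local Open Scope order_scope.

(** * Residuation for the Nelson implication *)

Section NelsonResiduation.
Context {d : Order.disp_t} {T : nelsonType d}.
Implicit Types x y z : T.

(** The hypotheses amount to [nimp x y = \top] and [nimp (dneg y) (dneg x) = \top], which together
    characterize the order of a Nelson algebra. The Kleene law controls the meet of [x] and
    [dneg x]. *)
Lemma le_dneg_join x y : x <= dneg x `|` y -> dneg y <= y `|` dneg x -> x <= y.
Proof.
move=> le1 le2; have le3 : x `&` dneg y <= y.
  by rewrite -le_dneg dnegI dnegK joinC.
have le4 : x `&` dneg x <= y.
  have /meet_idPl <- := kleene x y.
  by rewrite meetUr leUx leIr /= (le_trans _ le3) // leI2 // leIl.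
by have /meet_idPl <- := le1; rewrite meetUr leUx le4 leIr.
Qed.

Lemma meet_dneg_le_nimp x y : x `&` dneg x <= x `-> y.
Proof.
have : x `&` (dneg x `|` y) <= x `-> y by rewrite -meet_nimp leIr.
by apply: le_trans; rewrite leI2 // leUl.
Qed.

Lemma dneg_le_nimp x y : dneg x <= x `-> y.
Proof.
(* Contraction: the meet of [x] and [dneg x] implies [nimp x y], and after currying the repeated
   premise [x] is absorbed. *)
have /nimp1_le : dneg x `-> (x `-> y) = \top.
  by rewrite nimpA -(le_nimp1 (meet_dneg_le_nimp x y)) nimpA meetAC meetxx meetC.
rewrite dnegK => /meet_idPl <-.
by rewrite meetUr leUx leIr meetC meet_dneg_le_nimp.
Qed.

Lemma dneg_nimp_le x y : dneg (x `-> y) <= dneg x `|` (x `&` dneg y).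
Proof.
have := congr1 dneg (meet_nimp x y); rewrite !(dnegI, dnegU) dnegK => <-.
exact: leUr.
Qed.

Lemma le_nimp x y z : (z <= x `-> y) = (x `&` z <= dneg x `|` y).
Proof.
have le_dneg_nimp : dneg (x `-> y) <= (x `-> y) `|` (x `&` dneg y).
  by apply: le_trans (dneg_nimp_le x y) _; rewrite leU2 // dneg_le_nimp.
have le_r : y <= x `-> y.
  apply: le_dneg_join.
    by apply: nimp1_le; rewrite nimpA le_nimp1 // leIl.
  by apply: le_trans le_dneg_nimp _; rewrite leU2 // leIr.
apply/idP/idP => [le_z|le_xz].
  apply: le_trans (leI2 (lexx x) le_z) _.
  by rewrite meet_nimp leIr.
(* The first premise follows by the same contraction of [x], the second by negating [le_xz]. *)
apply: le_dneg_join.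
  apply: nimp1_le; have := @le_nimp1 _ _ (x `&` z) (x `-> y).
  rewrite !nimpA meetAC meetxx [z `&` x]meetC; apply.
  by apply: le_trans le_xz _; rewrite leUx dneg_le_nimp le_r.
apply: le_trans le_dneg_nimp _; rewrite leUx leUl /=.
move: le_xz; rewrite -le_dneg dnegI dnegU dnegK => /le_trans; apply.
by rewrite leU2 // dneg_le_nimp.
Qed.

Lemma nimp_eq1 x y : (x `-> y == \top) = (x <= dneg x `|` y).
Proof. by rewrite -le1x le_nimp meetx1. Qed.

End NelsonResiduation.

(** * Computation modulo the center *)

Section Center.
Context {d : Order.disp_t} {U : monadicNcType d}.
Implicit Types x y a b : U.

Lemma meet_dneg_le_center x : x `&` dneg x <= center.
Proof. by have := kleene x (center : U); rewrite dneg_center joinxx. Qed.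

Lemma center_le_join_dneg x : center <= x `|` dneg x.
Proof. by have := kleene (center : U) x; rewrite dneg_center meetxx. Qed.

(** Negating the hypothesis puts the meet of [dneg y] and [center] below [dneg x], and
    [center_le_join_dneg] allows [center] to be replaced by that meet. With [nimp_eq1], an
    inequality modulo the center becomes an implication equal to [\top]. *)
Lemma le_join_center x y : x <= y `|` center -> x <= dneg x `|` y.
Proof.
move=> le_xy; have le_nx : dneg y `&` center <= dneg x.
  by rewrite -{1}dneg_center -dnegU le_dneg.
have : x <= y `|` (dneg y `&` center).
  by rewrite joinIr lexI le_xy (le_trans le_xy) // leUx leUl center_le_join_dneg.
by move/le_trans; apply; rewrite joinC leU2.
Qed.

(* [dneg x], the obstruction to [x <= y], lies below the center. *)
Lemma nimp_eq1_le_center x y : x `-> y = \top -> center <= x ->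
  x <= y `|` center.
Proof.
move=> /nimp1_le le_x cx; apply: le_trans le_x _.
by rewrite joinC leU2 // dneg_le_center.
Qed.

Lemma joinc_nimp x y :
  (x `-> y) `|` center = (x `|` center) `-> (y `|` center).
Proof.
apply/le_anti/andP; split.
  rewrite leUx center_le_nimp ?leUr // andbT le_nimp.
  apply: (@le_trans _ _ (y `|` center)); last exact: leUr.
  rewrite meetUl leUx meet_nimp meetUr leUx.
  by rewrite !lexU2 ?meet_dneg_le_center ?leIr ?leIl ?orbT.
set z := _ `-> (y `|` center).
have cz : center <= z by rewrite center_le_nimp ?leUr.
(* After currying, the meet of [z] and [x] has to imply [y]; [le_join_center] reduces this to an
   inequality modulo [center], where residuation above the center applies. *)
apply: (nimp_eq1_le_center _ _ _ cz); rewrite nimpA; apply/eqP; rewrite nimp_eq1.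
apply: le_join_center; have : z <= z by [].
rewrite {2}/z le_nimp_center ?leUr //; apply: le_trans.
by rewrite leI2 ?leUl.
Qed.

Lemma dneg_nimp_joinc x y :
  dneg (x `-> y) `|` center = (x `|` center) `&` (dneg y `|` center).
Proof.
rewrite -joinIl; apply/le_anti/andP; split; rewrite leUx leUr andbT.
  have /meet_idPr <- : dneg (x `-> y) <= x.
    by rewrite -[leRHS]dnegK le_dneg dneg_le_nimp.
  apply: le_trans (leI2 (lexx x) (dneg_nimp_le x y)) _.
  by rewrite meetUr leUx !lexU2 ?meet_dneg_le_center ?leIr ?orbT.
(* Negation moves [center] to the left; bounding it by the join of [x] and [dneg x] splits the goal,
   and [meet_nimp] settles the case of [x]. *)
rewrite -le_dneg !(dnegU, dnegI, dnegK) dneg_center.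
apply: le_trans (leI2 (lexx _) (center_le_join_dneg x)) _.
by rewrite meetUr leUx [_ `&` x]meetC meet_nimp leIr leIxr ?leUl.
Qed.

(** The second equation negates to equality of the meets with [center], so distributivity gives
    cancellation. *)
Lemma joinc_dneg_inj x y :
  x `|` center = y `|` center -> dneg x `|` center = dneg y `|` center -> x = y.
Proof.
have le_xy u v : u `|` center = v `|` center ->
    dneg u `|` center = dneg v `|` center -> u <= v.
  move=> eU /(congr1 dneg); rewrite !(dnegU, dnegK) dneg_center => eI.
  by rewrite -[u](joinKI center) eU meetUr leUx leIr eI leIl.
by move=> eU eI; apply/le_anti; rewrite !le_xy.
Qed.

(** Currying turns [nimp a (nimp b \bot)] into [nimp center \bot], which is [\top] because
    [dneg center = center]. *)
Lemma joinc_preimage a b : center <= a -> a `&` b = center ->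
  (a `&` (b `-> \bot)) `|` center = a.
Proof.
move=> ca abc; rewrite joinIl (join_idPl ca); apply/meet_idPl.
apply: (nimp_eq1_le_center _ _ _ ca); rewrite nimpA abc.
by apply/eqP; rewrite nimp_eq1 joinx0 dneg_center.
Qed.

Lemma dneg_preimage_joinc a b : center <= a -> center <= b ->
  dneg (a `&` (b `-> \bot)) `|` center = b.
Proof.
move=> ca cb; rewrite dnegI -joinA dneg_nimp_joinc dneg0.
rewrite join1x meetx1 (join_idPl cb).
by apply/join_idPr; rewrite (le_trans (dneg_le_center ca)).
Qed.

End Center.

(** * Bijective homomorphisms are isomorphisms *)

Section Isomorphisms.
Context {d : Order.disp_t}.

Lemma mG_bij_iso (A B : mG d) (f : monadicGodel_hom A B) :
  bijective f -> is_iso (f : Hom A B).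
Proof.
case=> g fK gK; have [fI fU fi f0 f1 ff fe] := mG_morph f.
have gP : monadicGodel_morphism g.
  by split=> [x y|x y|x y|||x|x]; apply: (can_inj fK);
    rewrite ?(fI, fU, fi, f0, f1, ff, fe) !gK.
exists (MonadicGodelHom gP).
by split; apply: mG_hom_eq => x; rewrite /= ?fK ?gK.
Qed.

Lemma mNc_bij_iso (T U : mNc d) (f : monadicNc_hom T U) :
  bijective f -> is_iso (f : Hom T U).
Proof.
case=> g fK gK; have [fI fU fi fn f0 f1 fe] := mN_morph f.
have gP : monadicNc_morphism g.
  by split=> [x y|x y|x y|x|||x]; apply: (can_inj fK);
    rewrite ?(fI, fU, fi, fn, f0, f1, fe) !gK.
exists (MonadicNcHom gP).
by split; apply: mN_hom_eq => x; rewrite /= ?fK ?gK.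
Qed.

End Isomorphisms.

(** * The natural isomorphisms alpha and beta *)

Section UnitCounit.
Context {d : Order.disp_t}.

Section Unit.
Variable G : monadicGodelType d.

Lemma alphaP (x : G) :
  center <= @Twist d G (x, \bot) (introT eqP (meetx0 x)).
Proof. by rewrite le_twistE /= le0x lexx. Qed.

Definition alpha (x : G) : cone (twist G) := Cone (alphaP x).

Lemma alpha_morphism : monadicGodel_morphism alpha.
Proof.
split=> [x y|x y|x y|||x|x]; apply: val_inj; apply: twist_eq => //=.
- by rewrite joinxx.
- by rewrite meetxx.
- by rewrite meetx0.
- by rewrite hexists0.
- by rewrite hforall0.
Qed.

Lemma alpha_bij : bijective alpha.
Proof.
exists (fun p : cone (twist G) => (twist_val (cone_val p)).1) => // p.
apply: val_inj; apply: twist_eq => //=.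
(* Lying above the center [(\bot, \bot)] forces the second component to be [\bot]. *)
have := coneP p; rewrite le_twistE /= le0x /= lex0.
by move/eqP.
Qed.

Definition alpha_hom : monadicGodel_hom G (cone (twist G)) :=
  MonadicGodelHom alpha_morphism.

End Unit.

Section Counit.
Variable U : monadicNcType d.

Lemma joincP (x : U) : center <= x `|` center.
Proof. exact: leUr. Qed.

Lemma betaP (x : U) : Cone (joincP x) `&` Cone (joincP (dneg x)) == \bot.
Proof.
apply/eqP/val_inj; rewrite /= -joinIl.
exact/join_idPr/meet_dneg_le_center.
Qed.

Definition beta (x : U) : twist (cone U) :=
  @Twist d (cone U) (Cone (joincP x), Cone (joincP (dneg x))) (betaP x).

Lemma beta_morphism : monadicNc_morphism beta.
Proof.
split=> [x y|x y|x y|x|||x]; apply: twist_eq; apply: val_inj => /=.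
- by rewrite joinIl.
- by rewrite dnegI joinACA joinxx.
- by rewrite joinACA joinxx.
- by rewrite dnegU joinIl.
- exact: joinc_nimp.
- exact: dneg_nimp_joinc.
- by [].
- by rewrite dnegK.
- by rewrite join0x.
- by rewrite dneg0 join1x.
- by rewrite join1x.
- by rewrite dneg1 join0x.
- by rewrite nexistsU nexists_center.
(* Since [center] is a value of [nexists], [nforall] passes over the join with it. *)
- rewrite joinC -{2}nexists_center [_ `|` nexists _]joinC nforall_nexistsU.
  by rewrite nexists_center /nforall dnegK.
Qed.

Lemma beta_bij : bijective beta.
Proof.
pose g (p : twist (cone U)) : U :=
  cone_val p.1 `&` (cone_val p.2 `-> \bot).
have gK : cancel g beta.
  move=> p; have pI := congr1 val (twistP p).
  apply: twist_eq; apply: val_inj => /=.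
    by rewrite joinc_preimage ?coneP.
  by rewrite dneg_preimage_joinc ?coneP.
(* As [beta] is injective, its right inverse [g] is also a left inverse. *)
exists g => // x; apply: joinc_dneg_inj.
  exact: (congr1 (fun p : twist (cone U) => cone_val p.1) (gK (beta x))).
exact: (congr1 (fun p : twist (cone U) => cone_val p.2) (gK (beta x))).
Qed.

Definition beta_hom : monadicNc_hom U (twist (cone U)) :=
  MonadicNcHom beta_morphism.

End Counit.

Lemma alpha_natural (A B : mG d) (f : Hom A B) :
  @Defs.comp (mG d) _ _ _ (alpha_hom B) (fmap (functor_id (mG d)) f) =
  Defs.comp (fmap (functor_comp (functorC d) (functorK d)) f) (alpha_hom A).
Proof.
apply: mG_hom_eq => x; apply: val_inj; apply: twist_eq => //=.
by rewrite (mG_bot (mG_morph f)).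
Qed.

Lemma beta_natural (T U : mNc d) (f : Hom T U) :
  @Defs.comp (mNc d) _ _ _ (beta_hom U) (fmap (functor_id (mNc d)) f) =
  Defs.comp (fmap (functor_comp (functorK d) (functorC d)) f) (beta_hom T).
Proof.
apply: mN_hom_eq => x; have fM := mN_morph f.
by apply: twist_eq; apply: val_inj;
  rewrite /= (mN_join fM) ?(mN_dneg fM) mN_center.
Qed.

Definition alpha_iso :
    nat_iso (functor_id (mG d)) (functor_comp (functorC d) (functorK d)) :=
  @NatIso (mG d) (mG d) (functor_id (mG d))
    (functor_comp (functorC d) (functorK d)) alpha_hom alpha_natural
    (fun G => mG_bij_iso _ _ (alpha_hom G) (alpha_bij G)).

Definition beta_iso :
    nat_iso (functor_id (mNc d)) (functor_comp (functorK d) (functorC d)) :=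
  @NatIso (mNc d) (mNc d) (functor_id (mNc d))
    (functor_comp (functorK d) (functorC d)) beta_hom beta_natural
    (fun U => mNc_bij_iso _ _ (beta_hom U) (beta_bij U)).

End UnitCounit.

Theorem theorem3 (d : Order.disp_t) :
  exists e : equivalence (functorK d) (functorC d),
    (forall (G : monadicGodelType d) (x : G),
       let alpha : monadicGodel_hom G (cone (twist G)) := equiv_unit e G in
       twist_val (cone_val (alpha x)) = (x, \bot)) /\
    (forall (U : monadicNcType d) (x : U),
       let beta : monadicNc_hom U (twist (cone U)) := equiv_counit e U in
       cone_val (twist_val (beta x)).1 = x `|` center /\
       cone_val (twist_val (beta x)).2 = dneg x `|` center).
Proof.
by exists (Equivalence alpha_iso beta_iso).
Qed.
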